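(* Let $R$ be a commutative ring and let $\mathrm{Mod}(R)$ be the category of $R$-modules, equipped with the discrete model structure. Let $S$ be a commutative $R$-algebra. Then there exists a Bousfield localization of $\mathrm{Mod}(R)$ in which the base change functor $-\otimes_R S$ is a fibrant replacement monad if and only if the natural multiplication map $S\otimes_R S\rightarrow S$ is an isomorphism.
   Context: A model category is a finitely complete, finitely co-complete category with three classes of morphisms closed under retracts (cofibrations, weak equivalences, fibrations) such that: each morphism factors as an acyclic cofibration followed by a fibration, and as a cofibration followed by an acyclic fibration; weak equivalences have the two-out-of-three property; the cofibrations are precisely the maps with the left lifting property with respect to acyclic fibrations; the acyclic cofibrations are precisely the maps with the left lifting property with respect to the fibrations. (''Acyclic'' means also a weak equivalence.) Factorizations are not part of the structure and are not assumed functorial. An object is fibrant if its map to the terminal object is a fibration. The discrete model structure: all maps are cofibrations and fibrations, and the weak equivalences are the isomorphisms. A Bousfield localization of a model category $\mathcal{M}$ is a model category $\mathcal{M}'$ with the same underlying category, the same cofibrations, and whose collection of weak equivalences contains that of $\mathcal{M}$. The base change functor $-\otimes_R S$ is regarded as a monad on $\mathrm{Mod}(R)$ via the extension/restriction of scalars adjunction: its unit is $M\to M\otimes_R S$, $m\mapsto m\otimes 1$, and its multiplication is induced by the multiplication map $S\otimes_R S\to S$. A monad $(T,\eta,\mu)$ on a model category is a fibrant replacement monad if for every object $X$ the object $TX$ is fibrant and the unit $\eta_X:X\to TX$ is an acyclic cofibration. *)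

(* Defs.v *)
From HB Require Import structures.
From mathcomp Require Import all_boot all_order all_algebra.
From mathcomp Require Import boolp.

Set Implicit Arguments.
Unset Strict Implicit.
Unset Printing Implicit Defensive.

Import GRing.Theory.
Local Open Scope quotient_scope.
Local Open Scope ring_scope.

Record category := Category {
  ob :> Type;
  hom : ob -> ob -> Type;
  idm : forall X, hom X X;
  compm : forall X Y Z, hom Y Z -> hom X Y -> hom X Z;
  compmA : forall W X Y Z (h : hom Y Z) (g : hom X Y) (f : hom W X),
    compm h (compm g f) = compm (compm h g) f;
  comp1m : forall X Y (f : hom X Y), compm (idm Y) f = f;
  compm1 : forall X Y (f : hom X Y), compm f (idm X) = f }.

Arguments hom {c} X Y.
Arguments idm {c} X.
Arguments compm {c X Y Z} g f.

Declare Scope cat_scope.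
Delimit Scope cat_scope with cat.
Local Open Scope cat_scope.
Notation "g ∘ f" := (compm g f) (at level 40, left associativity) : cat_scope.

Record functor (C D : category) := Functor {
  fob :> C -> D;
  fmap : forall X Y, hom X Y -> hom (fob X) (fob Y);
  fmap1 : forall X, fmap (idm X) = idm (fob X);
  fmap_comp : forall X Y Z (g : hom Y Z) (f : hom X Y),
    fmap (g ∘ f) = fmap g ∘ fmap f }.

Arguments fmap {C D} _ {X Y} _.

Record monad (C : category) := Monad {
  mfun :> functor C C;
  munit : forall X : C, hom X (mfun X);
  mmult : forall X : C, hom (mfun (mfun X)) (mfun X);
  munit_nat : forall X Y (f : hom X Y), munit Y ∘ f = fmap mfun f ∘ munit X;
  mmult_nat : forall X Y (f : hom X Y),
    mmult Y ∘ fmap mfun (fmap mfun f) = fmap mfun f ∘ mmult X;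
  mmult_unitl : forall X, mmult X ∘ munit (mfun X) = idm (mfun X);
  mmult_unitr : forall X, mmult X ∘ fmap mfun (munit X) = idm (mfun X);
  mmultA : forall X, mmult X ∘ mmult (mfun X) = mmult X ∘ fmap mfun (mmult X) }.

Definition is_iso (C : category) (X Y : C) (f : hom X Y) : Prop :=
  exists g : hom Y X, g ∘ f = idm X /\ f ∘ g = idm Y.

Definition is_terminal (C : category) (Z : C) : Prop :=
  forall X : C, exists! f : hom X Z, True.

(* The library's finite_set constrains the universe of its carrier too much to *)
(* be applied to the objects of a category such as Mod below.                  *)
Definition is_finite (T : Type) : Prop :=
  exists (n : nat) (e : 'I_n -> T), forall x : T, exists i, e i = x.

Definition is_finite_category (J : category) : Prop :=
  is_finite J /\ forall i j : J, is_finite (hom i j).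

Section Limits.
Variables (J C : category) (F : functor J C).

Definition is_cone (L : C) (p : forall j, hom L (F j)) : Prop :=
  forall i j (u : hom i j), fmap F u ∘ p i = p j.

Definition is_limit (L : C) (p : forall j, hom L (F j)) : Prop :=
  is_cone p /\ forall (X : C) (q : forall j, hom X (F j)), is_cone q ->
    exists! h : hom X L, forall j, p j ∘ h = q j.

Definition is_cocone (L : C) (p : forall j, hom (F j) L) : Prop :=
  forall i j (u : hom i j), p j ∘ fmap F u = p i.

Definition is_colimit (L : C) (p : forall j, hom (F j) L) : Prop :=
  is_cocone p /\ forall (X : C) (q : forall j, hom (F j) X), is_cocone q ->
    exists! h : hom L X, forall j, h ∘ p j = q j.

End Limits.

Definition finitely_complete (C : category) : Prop :=
  forall (J : category) (F : functor J C), is_finite_category J ->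
    exists (L : C) (p : forall j, hom L (F j)), is_limit p.

Definition finitely_cocomplete (C : category) : Prop :=
  forall (J : category) (F : functor J C), is_finite_category J ->
    exists (L : C) (p : forall j, hom (F j) L), is_colimit p.

Definition morphism_class (C : category) := forall X Y : C, hom X Y -> Prop.

Definition is_retract (C : category) (A B X Y : C)
    (f : hom A B) (g : hom X Y) : Prop :=
  exists (i : hom A X) (r : hom X A) (j : hom B Y) (s : hom Y B),
    [/\ r ∘ i = idm A, s ∘ j = idm B, g ∘ i = j ∘ f & f ∘ r = s ∘ g].

Definition closed_under_retracts (C : category) (W : morphism_class C) : Prop :=
  forall (A B X Y : C) (f : hom A B) (g : hom X Y),
    is_retract f g -> W X Y g -> W A B f.

Definition has_lifting (C : category) (A B X Y : C)
    (i : hom A B) (p : hom X Y) : Prop :=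
  forall (a : hom A X) (b : hom B Y), p ∘ a = b ∘ i ->
    exists h : hom B X, h ∘ i = a /\ p ∘ h = b.

Record model_data (C : category) := ModelData {
  cof : morphism_class C;
  weq : morphism_class C;
  fib : morphism_class C }.

Arguments cof {C} m [X Y] f.
Arguments weq {C} m [X Y] f.
Arguments fib {C} m [X Y] f.

Section Model.
Variables (C : category) (M : model_data C).

Definition acyclic_cof : morphism_class C :=
  fun X Y f => cof M f /\ weq M f.

Definition acyclic_fib : morphism_class C :=
  fun X Y f => fib M f /\ weq M f.

Arguments acyclic_cof [X Y] f.
Arguments acyclic_fib [X Y] f.

Record is_model_category : Prop := IsModelCategory {
  model_complete : finitely_complete C;
  model_cocomplete : finitely_cocomplete C;
  cof_retract : closed_under_retracts (cof M);
  weq_retract : closed_under_retracts (weq M);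
  fib_retract : closed_under_retracts (fib M);
  factor_acof_fib : forall (X Y : C) (f : hom X Y),
    exists (Z : C) (i : hom X Z) (p : hom Z Y),
      [/\ f = p ∘ i, acyclic_cof i & fib M p];
  factor_cof_afib : forall (X Y : C) (f : hom X Y),
    exists (Z : C) (i : hom X Z) (p : hom Z Y),
      [/\ f = p ∘ i, cof M i & acyclic_fib p];
  weq_comp : forall (X Y Z : C) (g : hom Y Z) (f : hom X Y),
    weq M f -> weq M g -> weq M (g ∘ f);
  weq_cancell : forall (X Y Z : C) (g : hom Y Z) (f : hom X Y),
    weq M g -> weq M (g ∘ f) -> weq M f;
  weq_cancelr : forall (X Y Z : C) (g : hom Y Z) (f : hom X Y),
    weq M f -> weq M (g ∘ f) -> weq M g;
  cof_llp : forall (A B : C) (i : hom A B),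
    cof M i <-> forall (X Y : C) (p : hom X Y), acyclic_fib p -> has_lifting i p;
  acof_llp : forall (A B : C) (i : hom A B),
    acyclic_cof i <-> forall (X Y : C) (p : hom X Y), fib M p -> has_lifting i p }.

Definition fibrant (X : C) : Prop :=
  exists Z : C, is_terminal Z /\ forall f : hom X Z, fib M f.

Definition fibrant_replacement_monad (T : monad C) : Prop :=
  forall X : C, fibrant (T X) /\ acyclic_cof (munit T X).

End Model.

Definition discrete_model (C : category) : model_data C :=
  ModelData (fun _ _ _ => True) (@is_iso C) (fun _ _ _ => True).

Definition bousfield_localization (C : category) (M M' : model_data C) : Prop :=
  [/\ is_model_category M',
      forall (X Y : C) (f : hom X Y), cof M' f <-> cof M f &
      forall (X Y : C) (f : hom X Y), weq M f -> weq M' f].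

Lemma is_iso_id (C : category) (X : C) : is_iso (idm X).
Proof. by exists (idm X); rewrite comp1m. Qed.

Lemma discrete_is_model_category (C : category) :
  finitely_complete C -> finitely_cocomplete C ->
  is_model_category (discrete_model C).
Proof.
move=> hl hc; split=> //=.
- move=> A B X Y f g [i [r [j [s [ri sj gi fr]]]]] [g' [g'g gg']].
  exists (r ∘ g' ∘ j); split.
    by rewrite -compmA -gi -compmA (compmA g') g'g comp1m.
  by rewrite !compmA fr -(compmA s) gg' compm1.
- move=> X Y f; exists X, (idm X), f; rewrite compm1; split=> //; split=> //.
  exact: is_iso_id.
- move=> X Y f; exists Y, f, (idm Y); rewrite comp1m; split=> //; split=> //.
  exact: is_iso_id.
- move=> X Y Z g f [f' [f'f ff']] [g' [g'g gg']]; exists (f' ∘ g'); split.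
    by rewrite -compmA (compmA g') g'g comp1m.
  by rewrite -compmA (compmA f) ff' comp1m.
- move=> X Y Z g f [g' [g'g gg']] [h [hgf gfh]].
  have fh : f ∘ h = g'.
    by rewrite -(comp1m (f ∘ h)) -g'g -compmA (compmA g) gfh compm1.
  by exists (h ∘ g); rewrite -compmA hgf compmA fh.
- move=> X Y Z g f [f' [f'f ff']] [h [hgf gfh]].
  have hg : h ∘ g = f'.
    by rewrite -(compm1 (h ∘ g)) -ff' compmA -(compmA h) hgf comp1m.
  by exists (f ∘ h); rewrite -(compmA f) hg compmA gfh.
- move=> A B i; split=> // _ X Y p [_ [q [qp pq]]] a b pa.
  exists (q ∘ b); split; last by rewrite compmA pq comp1m.
  by rewrite -compmA -pa compmA qp comp1m.
- move=> A B i; split=> [[_ [k [ki ik]]] X Y p _ a b pa|lift].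
    exists (a ∘ k); split; first by rewrite -compmA ki compm1.
    by rewrite compmA pa -compmA ik compm1.
  have [|h [hi ih]] := lift A B i I (idm A) (idm B).
    by rewrite compm1 comp1m.
  by split=> //; exists h.
Qed.

Lemma linear_ext (R : pzRingType) (M N : lmodType R) (f g : {linear M -> N}) :
  f =1 g -> f = g.
Proof.
move=> /funext; case: f g => [f [[f1] [f2]]] [g [[g1] [g2]]] /= fg.
rewrite {}fg in f1 f2 *.
by rewrite (Prop_irrelevance f1 g1) (Prop_irrelevance f2 g2).
Qed.

Section ModCategory.
Variable R : pzRingType.

Definition mod_id (M : lmodType R) : {linear M -> M} := idfun.

Definition mod_comp (M N P : lmodType R) (g : {linear N -> P})
  (f : {linear M -> N}) : {linear M -> P} := g \o f.

Lemma mod_compE (M N P : lmodType R) (g : {linear N -> P})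
  (f : {linear M -> N}) x : mod_comp g f x = g (f x).
Proof. by []. Qed.

Lemma mod_idE (M : lmodType R) (x : M) : mod_id M x = x.
Proof. by []. Qed.

Definition Mod : category.
Proof.
refine (@Category (lmodType R) (fun M N => {linear M -> N}) mod_id mod_comp _ _ _).
- by move=> *; apply: linear_ext.
- by move=> *; apply: linear_ext.
- by move=> *; apply: linear_ext.
Defined.

End ModCategory.

Section Tensor.
Variables (R : comPzRingType) (M N : lmodType R).

(* A word [:: (m1, n1); ...; (mk, nk)] stands for m1 (x) n1 + ... + mk (x) nk. *)
(* The relation below presents M (x) N as the commutative monoid generated by  *)
(* the m (x) n subject to bilinearity; it is automatically a group, because    *)
(* (- m) (x) n is opposite to m (x) n.                                         *)
Inductive tensor_eqv : seq (M * N) -> seq (M * N) -> Prop :=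
| teqv_refl s : tensor_eqv s s
| teqv_sym s t : tensor_eqv s t -> tensor_eqv t s
| teqv_trans s t u : tensor_eqv s t -> tensor_eqv t u -> tensor_eqv s u
| teqv_cat s s' t t' : tensor_eqv s s' -> tensor_eqv t t' ->
    tensor_eqv (s ++ t) (s' ++ t')
| teqv_catC s t : tensor_eqv (s ++ t) (t ++ s)
| teqv_zero n : tensor_eqv [:: (0, n)] [::]
| teqv_addl m m' n : tensor_eqv [:: (m + m', n)] [:: (m, n); (m', n)]
| teqv_addr m n n' : tensor_eqv [:: (m, n + n')] [:: (m, n); (m, n')]
| teqv_scale a m n : tensor_eqv [:: (a *: m, n)] [:: (m, a *: n)].

Definition tensor_rel (s t : seq (M * N)) : bool := `[< tensor_eqv s t >].

Lemma tensor_rel_equiv : equiv_class_of tensor_rel.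
Proof.
split=> [s|s t|t s u].
- exact/asboolP/teqv_refl.
- by apply/asboolP/asboolP => /teqv_sym.
- by move=> /asboolP st /asboolP tu; apply/asboolP/(teqv_trans st tu).
Qed.

Canonical tensor_equiv_rel := EquivRelPack tensor_rel_equiv.

Definition tensor := {eq_quot tensor_rel}.

HB.instance Definition _ := Choice.on tensor.
HB.instance Definition _ := EqQuotient.on tensor.

Definition tensor_word (s : seq (M * N)) : tensor := \pi_tensor s.

Lemma tensor_wordP s t : tensor_word s = tensor_word t <-> tensor_eqv s t.
Proof.
split=> [|st]; first by move/eqmodP/asboolP.
by apply/eqmodP/asboolP.
Qed.

Lemma tensor_wordK x : tensor_word (repr x) = x.
Proof. exact: reprK. Qed.

Lemma repr_word s : tensor_eqv (repr (tensor_word s)) s.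
Proof. by apply/tensor_wordP; rewrite tensor_wordK. Qed.

Definition tensor_add (x y : tensor) := tensor_word (repr x ++ repr y).
Definition tensor_scale (a : R) (x : tensor) :=
  tensor_word [seq (a *: p.1, p.2) | p <- repr x].

Lemma tensor_add_word s t :
  tensor_add (tensor_word s) (tensor_word t) = tensor_word (s ++ t).
Proof. by apply/tensor_wordP/teqv_cat; apply: repr_word. Qed.

Lemma teqv_map_scale a s t : tensor_eqv s t ->
  tensor_eqv [seq (a *: p.1, p.2) | p <- s] [seq (a *: p.1, p.2) | p <- t].
Proof.
elim=> {s t} [s|s t _|s t u _ st _|s s' t t' _ ss' _ tt'|s t|n|m m' n|m n n'|b m n] /=.
- exact: teqv_refl.
- exact: teqv_sym.
- exact: teqv_trans.
- by rewrite !map_cat; apply: teqv_cat.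
- by rewrite !map_cat; apply: teqv_catC.
- by rewrite scaler0; apply: teqv_zero.
- by rewrite scalerDr; apply: teqv_addl.
- exact: teqv_addr.
- by rewrite scalerA mulrC -scalerA; apply: teqv_scale.
Qed.

Lemma tensor_scale_word a s :
  tensor_scale a (tensor_word s) = tensor_word [seq (a *: p.1, p.2) | p <- s].
Proof. by apply/tensor_wordP/teqv_map_scale/repr_word. Qed.

Lemma tensor_ind (P : tensor -> Prop) : (forall s, P (tensor_word s)) -> forall x, P x.
Proof. by move=> H x; rewrite -(tensor_wordK x). Qed.

Lemma tensor_addA : associative tensor_add.
Proof.
elim/tensor_ind=> s; elim/tensor_ind=> t; elim/tensor_ind=> u.
by rewrite !tensor_add_word catA.
Qed.

Lemma tensor_addC : commutative tensor_add.
Proof.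
elim/tensor_ind=> s; elim/tensor_ind=> t.
by rewrite !tensor_add_word; apply/tensor_wordP/teqv_catC.
Qed.

Lemma tensor_add0 : left_id (tensor_word [::]) tensor_add.
Proof. by elim/tensor_ind=> s; rewrite tensor_add_word. Qed.

Lemma tensor_addN : left_inverse (tensor_word [::]) (tensor_scale (-1)) tensor_add.
Proof.
elim/tensor_ind=> s; rewrite tensor_scale_word tensor_add_word.
apply/tensor_wordP; elim: s => [|[m n] s IHs] /=; first exact: teqv_refl.
rewrite -cat1s -(cat1s (m, n)).
apply: (@teqv_trans _ ([:: (-1 *: m, n); (m, n)] ++
    ([seq (-1 *: p.1, p.2) | p <- s] ++ s))).
  rewrite -(cat1s (-1 *: m, n) [:: _]) -!catA.
  apply: teqv_cat; first exact: teqv_refl.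
  rewrite !catA; apply: teqv_cat; last exact: teqv_refl.
  exact: teqv_catC.
rewrite -[X in tensor_eqv _ X]/([::] ++ [::]); apply: teqv_cat => //.
apply: (teqv_trans (teqv_sym (teqv_addl _ _ _))).
by rewrite scaleN1r addNr; apply: teqv_zero.
Qed.

HB.instance Definition _ :=
  GRing.isZmodule.Build tensor tensor_addA tensor_addC tensor_add0 tensor_addN.

Lemma tensor_scaleA a b x :
  tensor_scale a (tensor_scale b x) = tensor_scale (a * b) x.
Proof.
elim/tensor_ind: x => s; rewrite !tensor_scale_word -map_comp.
by congr tensor_word; apply: eq_map => p /=; rewrite scalerA.
Qed.

Lemma tensor_scale1 : left_id 1 tensor_scale.
Proof.
elim/tensor_ind=> s; rewrite tensor_scale_word; congr tensor_word.
by rewrite -[RHS]map_id; apply: eq_map => -[m n] /=; rewrite scale1r.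
Qed.

Lemma tensor_scaleDr : right_distributive tensor_scale +%R.
Proof.
move=> a; elim/tensor_ind=> s; elim/tensor_ind=> t.
rewrite [_ + _ in LHS]tensor_add_word !tensor_scale_word.
by rewrite [RHS]tensor_add_word map_cat.
Qed.

Lemma tensor_scaleDl x : {morph tensor_scale^~ x : a b / a + b}.
Proof.
move=> a b; elim/tensor_ind: x => s.
rewrite !tensor_scale_word [RHS]tensor_add_word; apply/tensor_wordP.
elim: s => [|[m n] s IHs] /=; first exact: teqv_refl.
rewrite scalerDl -cat1s.
apply: (teqv_trans (teqv_cat (teqv_addl _ _ _) IHs)).
rewrite -(cat1s (a *: m, n) [:: _]) -(cat1s (a *: m, n) (_ ++ _)).
rewrite -(cat1s (b *: m, n) [seq _ | _ <- _]) -!catA.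
apply: teqv_cat; first exact: teqv_refl.
rewrite !catA; apply: teqv_cat; last exact: teqv_refl.
exact: teqv_catC.
Qed.

HB.instance Definition _ := GRing.Zmodule_isLmodule.Build R tensor
  tensor_scaleA tensor_scale1 tensor_scaleDr tensor_scaleDl.

Definition pure_tensor (m : M) (n : N) : tensor := tensor_word [:: (m, n)].

Lemma tensor_word_sum s : tensor_word s = \sum_(p <- s) pure_tensor p.1 p.2.
Proof.
elim: s => [|[m n] s IHs]; first by rewrite big_nil.
by rewrite big_cons -IHs /= [RHS]tensor_add_word.
Qed.

Definition is_bilinear (P : lmodType R) (b : M -> N -> P) : Prop :=
  [/\ forall m m' n, b (m + m') n = b m n + b m' n,
      forall m n n', b m (n + n') = b m n + b m n',
      forall a m n, b (a *: m) n = a *: b m n &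
      forall a m n, b m (a *: n) = a *: b m n].

Lemma pure_tensor_bilinear : is_bilinear pure_tensor.
Proof.
split=> [m m' n|m n n'|a m n|a m n].
- by rewrite [RHS]tensor_add_word; apply/tensor_wordP/teqv_addl.
- by rewrite [RHS]tensor_add_word; apply/tensor_wordP/teqv_addr.
- by rewrite [RHS]tensor_scale_word.
- by rewrite [RHS]tensor_scale_word; apply/tensor_wordP/teqv_sym/teqv_scale.
Qed.

Lemma tensor_linear_ext (P : lmodType R) (f g : {linear tensor -> P}) :
  (forall m n, f (pure_tensor m n) = g (pure_tensor m n)) -> f = g.
Proof.
move=> fg; apply: linear_ext; elim/tensor_ind=> s.
by rewrite tensor_word_sum !linear_sum; apply: eq_bigr => p _.
Qed.

Section Lift.
Variables (P : lmodType R) (b : M -> N -> P).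

Definition tensor_lift (hb : is_bilinear b) (x : tensor) : P :=
  \sum_(p <- repr x) b p.1 p.2.

Variable hb : is_bilinear b.

Lemma teqv_lift s t : tensor_eqv s t ->
  \sum_(p <- s) b p.1 p.2 = \sum_(p <- t) b p.1 p.2.
Proof.
case: hb => bDl bDr bZl bZr.
elim=> {s t} [s|s t _|s t u _ st _|s s' t t' _ ss' _ tt'|s t|n|m m' n|m n n'|c m n] //=.
- by move=> <-.
- by rewrite !big_cat /= ss' tt'.
- by rewrite !big_cat /= addrC.
- by rewrite big_seq1 big_nil -(scale0r 0) bZl scale0r.
- by rewrite !big_cons !big_nil /= !addr0.
- by rewrite !big_cons !big_nil /= !addr0.
- by rewrite !big_seq1 /= bZl bZr.
Qed.

Lemma tensor_lift_word s :
  tensor_lift hb (tensor_word s) = \sum_(p <- s) b p.1 p.2.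
Proof. exact/teqv_lift/repr_word. Qed.

Lemma tensor_lift_linear : linear (tensor_lift hb).
Proof.
move=> a; elim/tensor_ind=> s; elim/tensor_ind=> t.
rewrite [a *: _]tensor_scale_word [_ + _ in LHS]tensor_add_word !tensor_lift_word.
rewrite big_cat big_map /= scaler_sumr; congr (_ + _).
by apply: eq_bigr => p _; case: hb => _ _ ->.
Qed.

HB.instance Definition _ :=
  GRing.isLinear.Build R tensor P *:%R (tensor_lift hb) tensor_lift_linear.

Lemma tensor_lift_pure m n : tensor_lift hb (pure_tensor m n) = b m n.
Proof. by rewrite tensor_lift_word big_seq1. Qed.

End Lift.
End Tensor.

Section TensorMap.
Variables (R : comPzRingType) (M M' N N' : lmodType R).
Variables (f : {linear M -> M'}) (g : {linear N -> N'}).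

Lemma tensor_map_bilinear :
  is_bilinear (fun m n => pure_tensor (f m) (g n) : tensor M' N').
Proof.
have [tDl tDr tZl tZr] := pure_tensor_bilinear M' N'.
by split=> *; rewrite ?linearD ?linearZ /= ?tDl ?tDr ?tZl ?tZr.
Qed.

Definition tensor_map : {linear tensor M N -> tensor M' N'} :=
  tensor_lift tensor_map_bilinear.

Lemma tensor_map_pure m n :
  tensor_map (pure_tensor m n) = pure_tensor (f m) (g n).
Proof. exact: tensor_lift_pure. Qed.

End TensorMap.

(* S as an R-module. The R-algebra structure of S is the ring morphism phi: the *)
(* algebra structures of the library would exclude S = 0.                       *)
Definition restrict_scalars (R S : comPzRingType) (phi : {rmorphism R -> S}) :
  Type := S.

Arguments restrict_scalars {R S} phi.

Section BaseChange.
Variables (R S : comPzRingType) (phi : {rmorphism R -> S}).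

Local Notation A := (restrict_scalars phi).

HB.instance Definition _ := GRing.ComPzRing.on A.

Definition restrict_scale (a : R) (s : A) : A := (phi a : A) * s.

Lemma restrict_scaleA a b s :
  restrict_scale a (restrict_scale b s) = restrict_scale (a * b) s.
Proof. by rewrite /restrict_scale mulrA rmorphM. Qed.

Lemma restrict_scale1 : left_id 1 restrict_scale.
Proof. by move=> s; rewrite /restrict_scale rmorph1 mul1r. Qed.

Lemma restrict_scaleDr : right_distributive restrict_scale +%R.
Proof. by move=> a s t; rewrite /restrict_scale mulrDr. Qed.

Lemma restrict_scaleDl s : {morph restrict_scale^~ s : a b / a + b}.
Proof. by move=> a b; rewrite /restrict_scale rmorphD mulrDl. Qed.

HB.instance Definition _ := GRing.Zmodule_isLmodule.Build R A
  restrict_scaleA restrict_scale1 restrict_scaleDr restrict_scaleDl.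

Lemma alg_mul_bilinear : is_bilinear (fun s t : A => s * t).
Proof.
split=> [s t u|s t u|a s t|a s t]; rewrite ?mulrDl ?mulrDr //.
  exact/esym/mulrA.
exact: mulrCA.
Qed.

Definition multiplication_map : {linear tensor A A -> A} :=
  tensor_lift alg_mul_bilinear.

Lemma alg_mulr_linear (t : A) : linear (fun s : A => s * t).
Proof.
by case: alg_mul_bilinear => mDl _ mZl _ a s u /=; rewrite mDl mZl.
Qed.

Definition alg_mulr (t : A) (s : A) : A := s * t.

HB.instance Definition _ (t : A) :=
  GRing.isLinear.Build R A A *:%R (alg_mulr t) (alg_mulr_linear t).

Section Components.
Variable M : lmodType R.

Lemma bc_unit_linear : linear (fun m : M => pure_tensor m (1 : A)).
Proof.
by case: (pure_tensor_bilinear M A) => tDl _ tZl _ a m n /=; rewrite tDl tZl.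
Qed.

Definition bc_unit_fun (m : M) : tensor M A := pure_tensor m (1 : A).

HB.instance Definition _ :=
  GRing.isLinear.Build R M (tensor M A) *:%R bc_unit_fun bc_unit_linear.

Definition bc_unit : {linear M -> tensor M A} := bc_unit_fun.

Lemma bc_mult_bilinear :
  is_bilinear (fun (x : tensor M A) (t : A) => tensor_map (mod_id M) (alg_mulr t) x).
Proof.
have [_ tDr _ tZr] := pure_tensor_bilinear M A.
have E t s : tensor_map (mod_id M) (alg_mulr t) (tensor_word s) =
    \sum_(p <- s) pure_tensor p.1 (p.2 * t).
  by rewrite tensor_word_sum linear_sum; apply: eq_bigr => p _; rewrite tensor_map_pure.
split=> [x y t|x t u|a x t|a x t]; rewrite ?linearD ?linearZ //.
- elim/tensor_ind: x => s; rewrite !E -big_split.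
  by apply: eq_bigr => p _; rewrite mulrDr tDr.
- elim/tensor_ind: x => s; rewrite !E scaler_sumr.
  apply: eq_bigr => p _; rewrite -tZr; congr pure_tensor.
  by case: alg_mul_bilinear => _ _ _; apply.
Qed.

(* (m (x) s) (x) t |-> m (x) st *)
Definition bc_mult : {linear tensor (tensor M A) A -> tensor M A} :=
  tensor_lift bc_mult_bilinear.

Lemma bc_mult_pure m s t :
  bc_mult (pure_tensor (pure_tensor m s) t) = pure_tensor m (s * t).
Proof. by rewrite [LHS]tensor_lift_pure tensor_map_pure. Qed.

End Components.

Lemma tensor2_linear_ext (M P : lmodType R)
    (f g : {linear tensor (tensor M A) A -> P}) :
  (forall m s t, f (pure_tensor (pure_tensor m s) t) =
                 g (pure_tensor (pure_tensor m s) t)) -> f = g.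
Proof.
move=> fg; apply: tensor_linear_ext => x t; elim/tensor_ind: x => w.
have [tDl _ tZl _] := pure_tensor_bilinear (tensor M A) A.
rewrite tensor_word_sum; elim: w => [|[m s] w IHw].
  rewrite !big_nil -(scale0r (0 : tensor M A)) tZl.
  by rewrite !linearZ /= !scale0r.
by rewrite !big_cons tDl !linearD IHw fg.
Qed.

Lemma tensor3_linear_ext (M P : lmodType R)
    (f g : {linear tensor (tensor (tensor M A) A) A -> P}) :
  (forall m s t u, f (pure_tensor (pure_tensor (pure_tensor m s) t) u) =
                   g (pure_tensor (pure_tensor (pure_tensor m s) t) u)) -> f = g.
Proof.
move=> fg; apply: tensor2_linear_ext => x t u; elim/tensor_ind: x => w.
have [tDl _ tZl _] := pure_tensor_bilinear (tensor M A) A.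
have [tDl' _ tZl' _] := pure_tensor_bilinear (tensor (tensor M A) A) A.
rewrite tensor_word_sum; elim: w => [|[m s] w IHw].
  rewrite !big_nil -(scale0r (0 : tensor M A)) tZl tZl'.
  by rewrite !linearZ /= !scale0r.
by rewrite !big_cons tDl tDl' !linearD IHw fg.
Qed.

Definition bc_map (M N : lmodType R) (f : {linear M -> N}) :
  {linear tensor M A -> tensor N A} := tensor_map f (mod_id A).

Lemma bc_map_pure (M N : lmodType R) (f : {linear M -> N}) m s :
  bc_map f (pure_tensor m s) = pure_tensor (f m) s.
Proof. exact: tensor_map_pure. Qed.

Lemma bc_unitE (M : lmodType R) (m : M) : bc_unit M m = pure_tensor m (1 : A).
Proof. by []. Qed.

Lemma bc_map_id (M : lmodType R) : bc_map (mod_id M) = mod_id (tensor M A).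
Proof. by apply: tensor_linear_ext => m s; rewrite bc_map_pure !mod_idE. Qed.

Lemma bc_map_comp (M N P : lmodType R) (g : {linear N -> P}) (f : {linear M -> N}) :
  bc_map (mod_comp g f) = mod_comp (bc_map g) (bc_map f).
Proof.
by apply: tensor_linear_ext => m s; rewrite mod_compE !bc_map_pure mod_compE.
Qed.

Definition base_change : functor (Mod R) (Mod R) :=
  @Functor (Mod R) (Mod R) (fun M : lmodType R => tensor M A : lmodType R)
    bc_map bc_map_id bc_map_comp.

Lemma bc_unit_nat (M N : lmodType R) (f : {linear M -> N}) :
  mod_comp (bc_unit N) f = mod_comp (bc_map f) (bc_unit M).
Proof.
by apply: linear_ext => m; rewrite !mod_compE !bc_unitE bc_map_pure.
Qed.

Lemma bc_mult_nat (M N : lmodType R) (f : {linear M -> N}) :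
  mod_comp (bc_mult N) (bc_map (bc_map f)) = mod_comp (bc_map f) (bc_mult M).
Proof.
apply: tensor2_linear_ext => m s t.
by rewrite !mod_compE bc_mult_pure !bc_map_pure bc_mult_pure.
Qed.

Lemma bc_unitl (M : lmodType R) :
  mod_comp (bc_mult M) (bc_unit (tensor M A)) = mod_id (tensor M A).
Proof.
apply: tensor_linear_ext => m s.
by rewrite mod_compE bc_unitE bc_mult_pure mulr1 mod_idE.
Qed.

Lemma bc_unitr (M : lmodType R) :
  mod_comp (bc_mult M) (bc_map (bc_unit M)) = mod_id (tensor M A).
Proof.
apply: tensor_linear_ext => m s.
by rewrite mod_compE bc_map_pure bc_unitE bc_mult_pure mul1r mod_idE.
Qed.

Lemma bc_multA (M : lmodType R) :
  mod_comp (bc_mult M) (bc_mult (tensor M A)) =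
  mod_comp (bc_mult M) (bc_map (bc_mult M)).
Proof.
apply: tensor3_linear_ext => m s t u.
by rewrite !mod_compE bc_map_pure !bc_mult_pure mulrA.
Qed.

Definition base_change_monad : monad (Mod R) :=
  @Monad (Mod R) base_change bc_unit bc_mult
    bc_unit_nat bc_mult_nat bc_unitl bc_unitr bc_multA.

End BaseChange.

Arguments multiplication_map {R S} phi.
Arguments bc_unit {R S} phi M.
Arguments bc_mult {R S} phi M.
Arguments bc_map {R S} phi {M N} f.
Arguments base_change {R S} phi.
Arguments base_change_monad {R S} phi.

(* Main.v *)
(* The acyclic cofibrations of a localization of the discrete structure are all*)
(* its weak equivalences.  If T = - (x) S is a fibrant replacement monad, then *)
(* maps into the fibrant object T T X are determined by their restriction along*)
(* the weak equivalence eta_X; hence eta_T = T eta, which for X = R says that  *)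
(* s (x) 1 = 1 (x) s in S (x) S.                                               *)
(*   Conversely, if T is idempotent, take as weak equivalences the maps inverted*)
(* by T, and as fibrations the maps with the right lifting property against    *)
(* them.  To factor f : X -> Y, let N be the smallest submodule of Y (+) T X that*)
(* contains the graph of (f, eta_X) and whose inclusion is a fibration.  The   *)
(* projection N -> T X splits T e, for e : X -> N; the subobject of N where    *)
(* eta_N is fixed by the resulting idempotent of T N is again a fibration      *)
(* containing the graph, so it is N, and T e is an isomorphism.                *)
Require Import Defs.
From HB Require Import structures.
From mathcomp Require Import all_boot all_order all_algebra.
From mathcomp Require Import boolp.
(* The library's vector.v also exports a [hom]. *)
Import Defs.

Set Implicit Arguments.
Unset Strict Implicit.
Unset Printing Implicit Defensive.

Import GRing.Theory.
Local Open Scope quotient_scope.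
Local Open Scope ring_scope.
Local Open Scope cat_scope.

(** * Submodules, quotients and finite biproducts *)

(** In a localization of the discrete structure all maps are cofibrations, so the weak equivalences
    are the maps lifting against every fibration. Maps into a fibrant object extend along a weak
    equivalence ([fibrant_extend]), and uniquely ([fibrant_separated]). If T = - ⊗ S is a fibrant
    replacement monad, both units X → TX → TTX agree after [η_X], hence [η_TX = T η_X]; at X = R
    this reads s ⊗ 1 = 1 ⊗ s, and s ↦ s ⊗ 1 inverts the multiplication.

    Conversely, a bijective multiplication makes T idempotent. Declare the maps inverted by T to be
    the weak equivalences and let the fibrations be defined by lifting. The substantial axiom is the
    factorization into an inverted map followed by a fibration ([mod_factor]). The pullback of T f
    along [η_Y] does not provide it when S is not flat: for 0 → Z and S = Z/2 it is 2Z, which T does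
    not kill. The middle object is instead cut out as a smallest closed submodule, and minimality
    forces the first factor to be inverted ([closure_inverted]). *)

Definition linear_of (R : pzRingType) (M N : lmodType R) (f : M -> N)
    (hf : linear f) : {linear M -> N} :=
  HB.pack f (GRing.isLinear.Build R M N *:%R f hf).

Lemma linear_ofE (R : pzRingType) (M N : lmodType R) (f : M -> N)
    (hf : linear f) x : linear_of hf x = f x.
Proof. by []. Qed.

(** Membership is a proposition because the submodules needed below are defined by quantifying over
    all modules; [submod_pred] makes it boolean. *)
Record submodule (R : pzRingType) (V : lmodType R) := Submodule {
  submod_mem :> V -> Prop;
  submod_mem0 : submod_mem 0;
  submod_memP : forall a u v, submod_mem u -> submod_mem v ->
    submod_mem (a *: u + v) }.

Section SubmoduleObject.
Variables (R : pzRingType) (V : lmodType R) (P : submodule V).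

Definition submod_pred : {pred V} := fun v => `[< P v >].

Lemma submod_pred_closed : submod_closed submod_pred.
Proof.
split=> [|a u v /asboolP Pu /asboolP Pv]; apply/asboolP.
  exact: submod_mem0.
exact: submod_memP.
Qed.

HB.instance Definition _ :=
  GRing.isSubmodClosed.Build R V submod_pred submod_pred_closed.

Record submod_type := SubmodType { submod_val :> V; _ : submod_pred submod_val }.
HB.instance Definition _ := [isSub for submod_val].
HB.instance Definition _ := [Choice of submod_type by <:].
HB.instance Definition _ := [SubChoice_isSubLmodule of submod_type by <:].
Definition submod_incl : {linear submod_type -> V} := \val.

Lemma submod_incl_inj : injective submod_incl.
Proof. exact: val_inj. Qed.

Lemma submod_inclP x : P (submod_incl x).
Proof. exact/asboolP/(valP x). Qed.

Section Lift.
Variables (W : lmodType R) (f : {linear W -> V}) (hf : forall w, P (f w)).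

Definition submod_lift_fun w : submod_type :=
  SubmodType (introT (asboolP (P (f w))) (hf w)).

Lemma submod_lift_linear : linear submod_lift_fun.
Proof. by move=> a u v; apply: submod_incl_inj; rewrite linearP /= linearP. Qed.

Definition submod_lift : {linear W -> submod_type} := linear_of submod_lift_linear.

Lemma submod_liftE w : submod_incl (submod_lift w) = f w.
Proof. by []. Qed.
End Lift.
End SubmoduleObject.


Section QuotientObject.
Variables (R : pzRingType) (V : lmodType R) (P : submodule V).

Definition submod_rel (u v : V) : bool := `[< P (u - v) >].

Lemma submod_memN u : P u -> P (- u).
Proof. by move=> Pu; have := submod_memP (-1) Pu (submod_mem0 P); rewrite addr0 scaleN1r. Qed.

Lemma submod_memD u v : P u -> P v -> P (u + v).
Proof. by move=> Pu Pv; rewrite -[u]scale1r; apply: submod_memP. Qed.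

Lemma submod_memZ a u : P u -> P (a *: u).
Proof. by move=> Pu; rewrite -[a *: u]addr0; apply/submod_memP/submod_mem0. Qed.

Lemma submod_rel_equiv : equiv_class_of submod_rel.
Proof.
split=> [u|u v|v u w].
- by apply/asboolP; rewrite subrr; apply: submod_mem0.
- by apply/asboolP/asboolP => /submod_memN; rewrite opprB.
- move=> /asboolP uv /asboolP vw; apply/asboolP.
  by rewrite -(subrKA v u); apply: submod_memD.
Qed.

Canonical submod_equiv_rel := EquivRelPack submod_rel_equiv.

Definition submod_quot := {eq_quot submod_rel}.

HB.instance Definition _ := Choice.on submod_quot.
HB.instance Definition _ := EqQuotient.on submod_quot.

Definition quot_class (u : V) : submod_quot := \pi_submod_quot u.

Lemma quot_classP u v : quot_class u = quot_class v <-> P (u - v).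
Proof.
split=> [|uv]; first by move/eqmodP/asboolP.
by apply/eqmodP/asboolP.
Qed.

Lemma quot_ind (Q : submod_quot -> Prop) :
  (forall u, Q (quot_class u)) -> forall x, Q x.
Proof. by move=> H x; rewrite -[x]reprK; apply: H. Qed.

Lemma repr_quot u : P (repr (quot_class u) - u).
Proof. by apply/quot_classP; rewrite /quot_class reprK. Qed.

Definition quot_add (x y : submod_quot) := quot_class (repr x + repr y).
Definition quot_opp (x : submod_quot) := quot_class (- repr x).
Definition quot_scale a (x : submod_quot) := quot_class (a *: repr x).

Lemma quot_addE u v : quot_add (quot_class u) (quot_class v) = quot_class (u + v).
Proof. by apply/quot_classP; rewrite opprD addrACA; apply/submod_memD; apply: repr_quot. Qed.

Lemma quot_oppE u : quot_opp (quot_class u) = quot_class (- u).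
Proof. by apply/quot_classP; rewrite -opprD; apply/submod_memN/repr_quot. Qed.

Lemma quot_scaleE a u : quot_scale a (quot_class u) = quot_class (a *: u).
Proof. by apply/quot_classP; rewrite -scalerBr; apply/submod_memZ/repr_quot. Qed.

Lemma quot_addA : associative quot_add.
Proof.
by elim/quot_ind=> u; elim/quot_ind=> v; elim/quot_ind=> w; rewrite !quot_addE addrA.
Qed.

Lemma quot_addC : commutative quot_add.
Proof. by elim/quot_ind=> u; elim/quot_ind=> v; rewrite !quot_addE addrC. Qed.

Lemma quot_add0 : left_id (quot_class 0) quot_add.
Proof. by elim/quot_ind=> u; rewrite quot_addE add0r. Qed.

Lemma quot_addN : left_inverse (quot_class 0) quot_opp quot_add.
Proof. by elim/quot_ind=> u; rewrite quot_oppE quot_addE addNr. Qed.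

HB.instance Definition _ :=
  GRing.isZmodule.Build submod_quot quot_addA quot_addC quot_add0 quot_addN.

Lemma quot_scaleA a b x : quot_scale a (quot_scale b x) = quot_scale (a * b) x.
Proof. by elim/quot_ind: x => u; rewrite !quot_scaleE scalerA. Qed.

Lemma quot_scale1 : left_id 1 quot_scale.
Proof. by elim/quot_ind=> u; rewrite quot_scaleE scale1r. Qed.

Lemma quot_scaleDr : right_distributive quot_scale +%R.
Proof.
move=> a; elim/quot_ind=> u; elim/quot_ind=> v.
by rewrite [_ + _ in LHS]quot_addE !quot_scaleE [RHS]quot_addE scalerDr.
Qed.

Lemma quot_scaleDl x : {morph quot_scale^~ x : a b / a + b}.
Proof.
move=> a b; elim/quot_ind: x => u.
by rewrite !quot_scaleE [RHS]quot_addE scalerDl.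
Qed.

HB.instance Definition _ := GRing.Zmodule_isLmodule.Build R submod_quot
  quot_scaleA quot_scale1 quot_scaleDr quot_scaleDl.

Lemma quot_class_linear : linear quot_class.
Proof. by move=> a u v; rewrite [a *: _ in RHS]quot_scaleE [RHS]quot_addE. Qed.

Definition quot_proj : {linear V -> submod_quot} := linear_of quot_class_linear.

Section Desc.
Variables (W : lmodType R) (f : {linear V -> W}) (hf : forall u, P u -> f u = 0).

Definition quot_desc_fun (x : submod_quot) : W := f (repr x).

Lemma quot_desc_funE u : quot_desc_fun (quot_class u) = f u.
Proof. by apply/subr0_eq; rewrite -linearB; apply/hf/repr_quot. Qed.

Lemma quot_desc_linear : linear quot_desc_fun.
Proof.
move=> a; elim/quot_ind=> u; elim/quot_ind=> v.
by rewrite -[in LHS]quot_class_linear !quot_desc_funE linearP.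
Qed.

Definition quot_desc : {linear submod_quot -> W} := linear_of quot_desc_linear.

Lemma quot_descE u : quot_desc (quot_proj u) = f u.
Proof. exact: quot_desc_funE. Qed.
End Desc.

End QuotientObject.

Section FiniteBiproduct.
Variables (R : pzRingType) (n : nat) (T : 'I_n -> lmodType R).

Definition biprod := {dffun forall i, T i}.
HB.instance Definition _ := Choice.on biprod.

Implicit Types x y z : biprod.
Definition biprod_zero : biprod := [ffun i : 'I_n => 0 : T i].
Definition biprod_add x y : biprod := [ffun i => x i + y i].
Definition biprod_opp x : biprod := [ffun i => - x i].
Definition biprod_scale a x : biprod := [ffun i => a *: x i].

Lemma biprod_addA : associative biprod_add.
Proof. by move=> x y z; apply/ffunP => i; rewrite !ffunE addrA. Qed.
Lemma biprod_addC : commutative biprod_add.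
Proof. by move=> x y; apply/ffunP => i; rewrite !ffunE addrC. Qed.
Lemma biprod_add0 : left_id biprod_zero biprod_add.
Proof. by move=> x; apply/ffunP => i; rewrite !ffunE add0r. Qed.
Lemma biprod_addN : left_inverse biprod_zero biprod_opp biprod_add.
Proof. by move=> x; apply/ffunP => i; rewrite !ffunE addNr. Qed.
HB.instance Definition _ :=
  GRing.isZmodule.Build biprod biprod_addA biprod_addC biprod_add0 biprod_addN.

Lemma biprod_scaleA a b x : biprod_scale a (biprod_scale b x) = biprod_scale (a * b) x.
Proof. by apply/ffunP => i; rewrite !ffunE scalerA. Qed.
Lemma biprod_scale1 : left_id 1 biprod_scale.
Proof. by move=> x; apply/ffunP => i; rewrite !ffunE scale1r. Qed.
Lemma biprod_scaleDr : right_distributive biprod_scale +%R.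
Proof. by move=> a x y; apply/ffunP => i; rewrite !ffunE scalerDr. Qed.
Lemma biprod_scaleDl x : {morph biprod_scale^~ x : a b / a + b}.
Proof. by move=> a b; apply/ffunP => i; rewrite !ffunE scalerDl. Qed.
HB.instance Definition _ := GRing.Zmodule_isLmodule.Build R biprod
  biprod_scaleA biprod_scale1 biprod_scaleDr biprod_scaleDl.

Lemma biprod_proj_linear i : linear (fun x : biprod => x i).
Proof. by move=> a x y; rewrite !ffunE. Qed.
Definition biprod_proj i : {linear biprod -> T i} := linear_of (biprod_proj_linear i).

Lemma biprodP (x y : biprod) : (forall i, biprod_proj i x = biprod_proj i y) -> x = y.
Proof. by move=> xy; apply/ffunP. Qed.

Definition biprod_tuple (t : forall i, T i) : biprod := [ffun i => t i].

Lemma biprod_tupleE t i : biprod_proj i (biprod_tuple t) = t i.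
Proof. exact: ffunE. Qed.

Section Pair.
Variables (W : lmodType R) (g : forall i, {linear W -> T i}).

Lemma biprod_pair_linear : linear (fun w => biprod_tuple (fun i => g i w)).
Proof.
by move=> a u v; apply: biprodP => i; rewrite linearP !biprod_tupleE linearP.
Qed.

Definition biprod_pair : {linear W -> biprod} := linear_of biprod_pair_linear.

Lemma biprod_pairE i w : biprod_proj i (biprod_pair w) = g i w.
Proof. exact: biprod_tupleE. Qed.
End Pair.

Definition biprod_inj_fun i (t : T i) : biprod :=
  biprod_tuple (dfwith (fun j => 0 : T j) t).

Lemma biprod_inj_linear i : linear (@biprod_inj_fun i).
Proof.
move=> a s t; apply: biprodP => j.
rewrite linearP !biprod_tupleE; have [<-|ij] := eqVneq i j.
  by rewrite !dfwith_in.
by rewrite !dfwith_out // scaler0 addr0.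
Qed.
Definition biprod_inj i : {linear T i -> biprod} := linear_of (@biprod_inj_linear i).

Lemma biprod_projK i t : biprod_proj i (biprod_inj i t) = t.
Proof. by rewrite biprod_tupleE dfwith_in. Qed.

Lemma biprod_proj_inj0 i j t : i != j -> biprod_proj j (biprod_inj i t) = 0.
Proof. by move=> ij; rewrite biprod_tupleE dfwith_out. Qed.

Lemma biprod_sum x : x = \sum_i biprod_inj i (biprod_proj i x).
Proof.
apply: biprodP => j; rewrite linear_sum (bigD1 j) // biprod_projK big1.
  exact/esym/addr0.
by move=> i ij; rewrite biprod_proj_inj0.
Qed.

Section Copair.
Variables (W : lmodType R) (g : forall i, {linear T i -> W}).

Lemma biprod_copair_linear : linear (fun x : biprod => \sum_i g i (biprod_proj i x)).
Proof.
move=> a x y; rewrite scaler_sumr -big_split; apply: eq_bigr => i _.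
by rewrite !linearP.
Qed.
Definition biprod_copair : {linear biprod -> W} := linear_of biprod_copair_linear.

Lemma biprod_copair_inj i t : biprod_copair (biprod_inj i t) = g i t.
Proof.
rewrite [LHS](bigD1 i) // biprod_projK big1; first exact: addr0.
by move=> j ji; rewrite biprod_proj_inj0 ?linear0 // eq_sym.
Qed.
End Copair.

End FiniteBiproduct.

Arguments biprod_proj {R n T} i.
Arguments biprod_inj {R n T} i.

(** * Finite limits and colimits of modules *)

Section ModLimits.
Variables (R : pzRingType) (J : category) (F : functor J (Mod R)).
Variables (n : nat) (e : 'I_n -> J).
Hypothesis e_surj : forall j : J, exists i, e i = j.

Local Notation T := (fun i => F (e i) : lmodType R).
Local Notation fm u := (fmap F u : {linear _ -> _}).

Lemma fmap_compE i j k (v : hom j k) (u : hom i j) x :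
  fm (v ∘ u) x = fm v (fm u x).
Proof. by rewrite fmap_comp. Qed.

Lemma cone_app (X : Mod R) (q : forall j, hom X (F j)) : is_cone q ->
  forall i j (u : hom i j) x, fm u ((q i : {linear _ -> _}) x) = (q j : {linear _ -> _}) x.
Proof. by move=> qc i j u x; rewrite -(qc _ _ u). Qed.

Lemma cocone_app (X : Mod R) (q : forall j, hom (F j) X) : is_cocone q ->
  forall i j (u : hom i j) x, (q j : {linear _ -> _}) (fm u x) = (q i : {linear _ -> _}) x.
Proof. by move=> qc i j u x; rewrite -(qc _ _ u). Qed.

(** Replaces transport along [e i = j] by morphisms of J, through which F can be applied. *)
Lemma index_iso j :
  {i : 'I_n & {u : hom (e i) j & {v : hom j (e i) | u ∘ v = idm j}}}.
Proof.
by have [i <-] := cid (e_surj j); exists i, (idm _), (idm _); rewrite comp1m.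
Qed.

Let ix j := projT1 (index_iso j).
Let iu j : hom (e (ix j)) j := projT1 (projT2 (index_iso j)).
Let iv j : hom j (e (ix j)) := sval (projT2 (projT2 (index_iso j))).
Let iuv j : iu j ∘ iv j = idm j := svalP (projT2 (projT2 (index_iso j))).

Lemma compatible_submodule : exists P : submodule (biprod T),
  forall x, P x <-> forall i k (u : hom (e i) (e k)),
    fm u (biprod_proj i x) = biprod_proj k x.
Proof.
unshelve eexists (@Submodule R (biprod T) (fun x : biprod T =>
  forall i k (u : hom (e i) (e k)), fm u (biprod_proj i x) = biprod_proj k x) _ _).
- by move=> i k u; rewrite !linear0.
- by move=> a x y hx hy i k u; rewrite !linearP hx hy.
by [].
Qed.

Lemma mod_limit : exists (L : Mod R) (p : forall j, hom L (F j)), is_limit p.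
Proof.
have [P PE] := compatible_submodule.
exists (submod_type P : lmodType R).
exists (fun j => mod_comp (fm (iu j))
          (mod_comp (biprod_proj (T := T) (ix j)) (submod_incl P))); split.
  move=> j k u; apply: linear_ext => x.
  have /PE xP := submod_inclP x.
  (* The component at the index of k is the image of the one at the index of j; then [iu k] cancels
     [iv k]. *)
  rewrite !mod_compE -(xP (ix j) _ (iv k ∘ u ∘ iu j)) -!fmap_compE.
  by rewrite !compmA iuv comp1m.
move=> X q qc.
pose t := biprod_pair (T := T) (fun i => q (e i)).
have tP x : P (t x).
  by apply/PE => i k u; rewrite !biprod_pairE (cone_app qc).
exists (submod_lift tP); split=> [j|h hq]; apply: linear_ext => x.
  by rewrite !mod_compE biprod_pairE (cone_app qc).
apply/submod_incl_inj/biprodP => i; rewrite submod_liftE biprod_pairE.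
have /PE xP := submod_inclP (h x).
by rewrite -hq !mod_compE xP.
Qed.

Definition cocone_sum (X : Mod R) (q : forall j, hom (F j) X) :
  {linear biprod T -> X : lmodType R} := biprod_copair (T := T) (fun i => q (e i)).

(* The colimit is the quotient of the direct sum by this submodule, so that no *)
(* generators for it are needed.                                               *)
Lemma cocone_kernel : exists P : submodule (biprod T),
  forall x, P x <-> forall (X : Mod R) (q : forall j, hom (F j) X),
    is_cocone q -> cocone_sum q x = 0.
Proof.
unshelve eexists (@Submodule R (biprod T) (fun x : biprod T =>
  forall (X : Mod R) (q : forall j, hom (F j) X),
    is_cocone q -> cocone_sum q x = 0) _ _).
- by move=> X q _; rewrite linear0.
- by move=> a x y hx hy X q qc; rewrite linearP hx // hy // scaler0 addr0.
by [].
Qed.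

Lemma mod_colimit : exists (L : Mod R) (p : forall j, hom (F j) L), is_colimit p.
Proof.
have [P PE] := cocone_kernel.
exists (submod_quot P : lmodType R).
exists (fun j => mod_comp (quot_proj P)
          (mod_comp (biprod_inj (T := T) (ix j)) (fm (iv j)))); split.
  move=> j k u; apply: linear_ext => x; rewrite !mod_compE.
  apply/quot_classP/PE => X q qc.
  by rewrite linearB !biprod_copair_inj -!fmap_compE !(cocone_app qc) subrr.
move=> X q qc.
have qP u : P u -> cocone_sum q u = 0 by move/PE; apply.
exists (quot_desc qP); split=> [j|h hq].
  apply: linear_ext => x.
  by rewrite !mod_compE quot_descE biprod_copair_inj (cocone_app qc).
apply: linear_ext; elim/quot_ind=> u; rewrite -[quot_class P u]/(quot_proj P u) quot_descE.
rewrite (biprod_sum u) !linear_sum; apply: eq_bigr => i _.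
rewrite biprod_copair_inj -hq !mod_compE; congr (h _).
(* Since [e] may repeat objects, summand i may differ from the one chosen for [e i]; every cocone
   identifies the two. *)
apply/quot_classP/PE => Y r rc.
by rewrite linearB !biprod_copair_inj (cocone_app rc) subrr.
Qed.

End ModLimits.

Lemma mod_finitely_complete (R : pzRingType) : finitely_complete (Mod R).
Proof. by move=> J F [[n [e e_surj]] _]; apply: mod_limit e_surj. Qed.

Lemma mod_finitely_cocomplete (R : pzRingType) : finitely_cocomplete (Mod R).
Proof. by move=> J F [[n [e e_surj]] _]; apply: mod_colimit e_surj. Qed.

(** * Objects that are fibrant in a localization of the discrete structure *)

Definition is_product (C : category) (X Y P : C) (p1 : hom P X) (p2 : hom P Y) :=
  forall (Z : C) (f : hom Z X) (g : hom Z Y),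
    exists! h : hom Z P, p1 ∘ h = f /\ p2 ∘ h = g.

Lemma product_ext (C : category) (X Y P Z : C) (p1 : hom P X) (p2 : hom P Y)
    (h k : hom Z P) :
  is_product p1 p2 -> p1 ∘ h = p1 ∘ k -> p2 ∘ h = p2 ∘ k -> h = k.
Proof.
move=> prodP e1 e2; have [t [_ tuniq]] := prodP _ (p1 ∘ k) (p2 ∘ k).
by rewrite -(tuniq h) // (tuniq k).
Qed.

Section LocalObjects.
Variables (C : category) (M : model_data C).
Hypotheses (hM : is_model_category M) (all_cof : forall X Y (f : hom X Y), cof M f).

Lemma weq_lift (X Y A B : C) (p : hom X Y) (f : hom A B) :
  fib M p -> weq M f -> has_lifting f p.
Proof.
by move=> pfib fweq; apply: (iffLR (acof_llp hM f)) pfib; split.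
Qed.

Lemma weq_idm (X : C) : weq M (idm X).
Proof.
apply: (proj2 (iffRL (acof_llp hM (idm X)) _)) => A B p _ a b.
by rewrite compm1 => pa; exists a; rewrite compm1.
Qed.

Lemma fibrant_extend (Y A B : C) (f : hom A B) (a : hom A Y) :
  fibrant M Y -> weq M f -> exists h : hom B Y, h ∘ f = a.
Proof.
move=> [Z [Zterm Zfib]] fweq.
have [z _] := Zterm Y; have [b _] := Zterm B.
have [|h [hf _]] := weq_lift (Zfib z) fweq (a := a) (b := b); last by exists h.
by have [t [_ tuniq]] := Zterm A; rewrite -(tuniq (z ∘ a)) // -(tuniq (b ∘ f)).
Qed.

(* [P] below is a path object of [Y]; since a weak equivalence lifting against *)
(* itself is an isomorphism, the diagonal of [Y] is itself a fibration.        *)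
Lemma fibrant_separated (Y YY A B : C) (p1 p2 : hom YY Y) (f : hom A B)
    (h1 h2 : hom B Y) :
  is_product p1 p2 -> fibrant M Y -> weq M f -> h1 ∘ f = h2 ∘ f -> h1 = h2.
Proof.
move=> YYprod Yfib fweq h12.
have [diag [[d1 d2] _]] := YYprod _ (idm Y) (idm Y).
have [h [[hh1 hh2] _]] := YYprod _ h1 h2.
have [P [i [p [dE [_ iweq] pfib]]]] := factor_acof_fib hM diag.
have qi : p1 ∘ p ∘ i = idm Y by rewrite -compmA -dE d1.
have qweq : weq M (p1 ∘ p) by apply: (weq_cancelr hM iweq); rewrite qi; apply: weq_idm.
(* The bottom map of the lifting problem against [p] has first coordinate b; fibrancy of Y supplies
   the second by extending along [p1 ∘ p]. *)
have qlift : has_lifting (p1 ∘ p) (p1 ∘ p).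
  move=> a b ab.
  have [c ca] := fibrant_extend (p2 ∘ p ∘ a) Yfib qweq.
  have [k [[k1 k2] _]] := YYprod _ b c.
  have kE : p ∘ a = k ∘ (p1 ∘ p).
    apply: (product_ext YYprod); first by rewrite compmA ab [RHS]compmA k1.
    by rewrite compmA [RHS]compmA k2 ca.
  have [l [la pl]] := weq_lift pfib qweq kE.
  by exists l; split=> //; rewrite -compmA pl.
have [|q' [q'q qq']] := qlift (idm P) (idm Y); first by rewrite compm1 comp1m.
have q'i : q' = i by rewrite -(compm1 q') -qi compmA q'q comp1m.
subst q'.
have [|l [lf pl]] := weq_lift pfib fweq (a := i ∘ (h1 ∘ f)) (b := h).
  rewrite compmA -dE; apply: (product_ext YYprod); rewrite !compmA.
    by rewrite d1 comp1m hh1.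
  by rewrite d2 comp1m hh2 h12.
(* The pair (h1, h2) thus factors through the diagonal. *)
have ph : diag ∘ (p1 ∘ p ∘ l) = h by rewrite dE -compmA (compmA i) q'q comp1m.
by rewrite -hh1 -hh2 -ph !compmA d1 d2.
Qed.
End LocalObjects.

(** Naturality of the unit at [munit T X] says that the two maps agree after this weak equivalence,
    and their target is fibrant. *)
Lemma fibrant_replacement_unit (C : category) (M : model_data C) (T : monad C) (X YY : C)
    (p1 p2 : hom YY (T (T X))) :
  is_model_category M -> (forall X Y (f : hom X Y), cof M f) ->
  fibrant_replacement_monad M T -> is_product p1 p2 ->
  munit T (T X) = fmap T (munit T X).
Proof.
move=> hM all_cof hT YYprod.
have [TTfib _] := hT (T X); have [_ [_ eweq]] := hT X.
apply: (fibrant_separated hM all_cof YYprod TTfib eweq).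
exact: munit_nat.
Qed.

(** * The localization at the maps inverted by an idempotent monad *)

Section Localization.
Variables (C : category) (T : monad C).

Definition inverted : morphism_class C := fun X Y f => is_iso (fmap T f).
Arguments inverted [X Y] f.

Definition inverted_fib : morphism_class C := fun X Y p =>
  forall (A B : C) (f : hom A B), inverted f -> has_lifting f p.

Definition localization : model_data C :=
  ModelData (fun _ _ _ => True) inverted inverted_fib.

(** With g inverse to T f, the extension is μ ∘ T a ∘ g ∘ η: naturality of η and the unit law
    restrict it to a. *)
Lemma inverted_extend (A B X : C) (f : hom A B) (a : hom A (T X)) :
  inverted f -> exists h : hom B (T X), h ∘ f = a.
Proof.
move=> [g [gf fg]]; exists (mmult T X ∘ (fmap T a ∘ (g ∘ munit T B))).
rewrite -!compmA munit_nat (compmA g) gf comp1m -munit_nat compmA.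
by rewrite mmult_unitl comp1m.
Qed.

(** As T f is epi, T h1 = T h2; a map h into TX is recovered as μ ∘ T h ∘ η. *)
Lemma inverted_separated (A B X : C) (f : hom A B) (h1 h2 : hom B (T X)) :
  inverted f -> h1 ∘ f = h2 ∘ f -> h1 = h2.
Proof.
move=> [g [gf fg]] h12.
have Th : fmap T h1 = fmap T h2.
  rewrite -(compm1 (fmap T h1)) -(compm1 (fmap T h2)) -fg !compmA.
  by rewrite -!fmap_comp h12.
rewrite -(comp1m h1) -(comp1m h2) -(mmult_unitl T X) -!compmA !munit_nat.
by rewrite Th.
Qed.

Lemma inverted_fib_cod (X Z : C) (p : hom (T X) Z) :
  is_terminal Z -> inverted_fib p.
Proof.
move=> Zterm A B f finv a b _; have [h hf] := inverted_extend a finv.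
exists h; split=> //; have [t [_ tuniq]] := Zterm B.
by rewrite -(tuniq b) // (tuniq (p ∘ h)).
Qed.

Hypotheses (hl : finitely_complete C) (hc : finitely_cocomplete C).
Hypothesis factor : forall (X Y : C) (f : hom X Y),
  exists (Z : C) (i : hom X Z) (p : hom Z Y),
    [/\ f = p ∘ i, inverted i & inverted_fib p].

Lemma inverted_iso (X Y : C) (f : hom X Y) : is_iso f -> inverted f.
Proof.
by move=> [g [gf fg]]; exists (fmap T g); rewrite -!fmap_comp gf fg !fmap1.
Qed.

Lemma inverted_retract : closed_under_retracts inverted.
Proof.
move=> A B X Y f g [i [r [j [s [ri sj gi fr]]]]].
apply: (weq_retract (discrete_is_model_category hl hc)).
exists (fmap T i), (fmap T r), (fmap T j), (fmap T s).
by rewrite -!fmap_comp ri sj gi fr !fmap1.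
Qed.

Lemma inverted_fib_iso (X Y : C) (p : hom X Y) :
  inverted_fib p -> inverted p -> is_iso p.
Proof.
move=> pfib pinv; have [|h [hp ph]] := pfib _ _ _ pinv (idm X) (idm Y).
  by rewrite compm1 comp1m.
by exists h.
Qed.

(** Two-out-of-three and retracts are pulled back along T from the isomorphisms. Acyclic fibrations
    are isomorphisms, so everything lifts against them. *)
Lemma localization_is_model_category : is_model_category localization.
Proof.
have D := discrete_is_model_category hl hc.
split=> //=.
- exact: inverted_retract.
- move=> A B X Y f g [i [r [j [s [ri sj gi fr]]]]] gfib A' B' u uinv a b ab.
  have [|h [hu gh]] := gfib _ _ _ uinv (i ∘ a) (j ∘ b).
    by rewrite compmA gi -!compmA ab.
  exists (r ∘ h); rewrite -compmA hu !compmA ri fr comp1m; split=> //.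
  by rewrite -compmA gh compmA sj comp1m.
- move=> X Y f; have [Z [i [p [fE iinv pfib]]]] := factor f.
  by exists Z, i, p.
- move=> X Y f; exists Y, f, (idm Y); rewrite comp1m; split=> //; split.
    move=> A B u _ a b ab; exists b; rewrite -ab !comp1m //.
  exact/inverted_iso/is_iso_id.
- by move=> X Y Z g f finv ginv; rewrite /inverted fmap_comp; apply: (weq_comp D).
- move=> X Y Z g f ginv; rewrite /inverted fmap_comp; exact: (weq_cancell D).
- move=> X Y Z g f finv; rewrite /inverted fmap_comp; exact: (weq_cancelr D).
- move=> A B i; split=> // _ X Y p [pfib pinv].
  apply: (iffLR (cof_llp D i)) => //=; split=> //.
  exact: inverted_fib_iso.
- move=> A B i; split=> [[_ iinv] X Y p pfib|lift]; first exact: pfib.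
  split=> //; have [Z [e [p [iE einv pfib]]]] := factor i.
  have [|h [hi ph]] := lift _ _ p pfib e (idm B); first by rewrite comp1m.
  apply: inverted_retract einv.
  (* The retract argument: lifting i against p exhibits it as a retract of the inverted map e. *)
  by exists (idm A), (idm A), h, p; rewrite !compm1.
Qed.

Lemma localization_bousfield :
  bousfield_localization (discrete_model C) localization.
Proof.
split=> //; first exact: localization_is_model_category.
exact: inverted_iso.
Qed.

Lemma localization_fibrant_replacement (Z : C) :
  is_terminal Z -> (forall X, inverted (munit T X)) ->
  fibrant_replacement_monad localization T.
Proof.
move=> Zterm idem X; split; last by split=> //; apply: idem.
by exists Z; split=> // p; apply: inverted_fib_cod.
Qed.

End Localization.

(** * Factorization of module maps through a closed submodule *)

Lemma compE (R : pzRingType) (X Y Z : Mod R) (g : hom Y Z) (f : hom X Y)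
    (x : X : lmodType R) :
  (g ∘ f : {linear _ -> _}) x = (g : {linear _ -> _}) ((f : {linear _ -> _}) x).
Proof. by []. Qed.

Lemma hom_app (R : pzRingType) (X Y : Mod R) (f g : hom X Y) (x : X : lmodType R) :
  f = g -> (f : {linear _ -> _}) x = (g : {linear _ -> _}) x.
Proof. by move=> ->. Qed.

Section ModProduct.
Variables (R : pzRingType) (X Y : lmodType R).

Lemma prod_fst_linear : linear (fun v : X * Y => v.1).
Proof. by []. Qed.
Lemma prod_snd_linear : linear (fun v : X * Y => v.2).
Proof. by []. Qed.

Lemma prod_pair_linear (Z : lmodType R) (f : {linear Z -> X}) (g : {linear Z -> Y}) :
  linear (fun z => (f z, g z)).
Proof. by move=> a u v; rewrite !linearP. Qed.

Lemma mod_product :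
  @is_product (Mod R) X Y (X * Y)%type (linear_of prod_fst_linear)
    (linear_of prod_snd_linear).
Proof.
move=> Z f g; exists (linear_of (prod_pair_linear f g)).
split=> [|h [<- <-]]; first by split; apply: linear_ext.
by apply: linear_ext => z; rewrite linear_ofE !mod_compE /=; case: (h z).
Qed.
End ModProduct.

Section ModFactor.
Variables (R : pzRingType) (T : monad (Mod R)).
Hypothesis idem : forall X, inverted T (munit T X).

Local Notation ap f := (f : {linear _ -> _}).

(** The right lifting property of the inclusion of P: a lift through an injection is unique, so only
    membership has to be checked. *)
Definition inverted_closed (V : lmodType R) (P : V -> Prop) : Prop :=
  forall (A B : Mod R) (f : hom A B) (b : hom B V), inverted T f ->
    (forall a, P (ap b (ap f a))) -> forall x, P (ap b x).

(** An impredicative intersection of closed submodules, which takes the place of a transfinite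
    construction. *)
Definition closure_mem (X V : lmodType R) (g : {linear X -> V}) (v : V) : Prop :=
  forall Q : submodule V, inverted_closed Q -> (forall x, Q (g x)) -> Q v.

Lemma closure_mem0 (X V : lmodType R) (g : {linear X -> V}) : closure_mem g 0.
Proof. by move=> Q _ _; apply: submod_mem0. Qed.

Lemma closure_memP (X V : lmodType R) (g : {linear X -> V}) a u v :
  closure_mem g u -> closure_mem g v -> closure_mem g (a *: u + v).
Proof. by move=> hu hv Q Qc Qg; apply: submod_memP; [apply: hu|apply: hv]. Qed.

Definition closure (X V : lmodType R) (g : {linear X -> V}) : submodule V :=
  Submodule (@closure_mem0 X V g) (@closure_memP X V g).

Lemma closure_closed (X V : lmodType R) (g : {linear X -> V}) :
  inverted_closed (closure g).
Proof.
move=> A B f b finv bf x Q Qc Qg; apply: (Qc _ _ _ _ finv) => a.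
exact: bf.
Qed.

Lemma closure_gen (X V : lmodType R) (g : {linear X -> V}) x : closure g (g x).
Proof. by move=> Q _; apply. Qed.

Lemma submod_incl_fib (V : lmodType R) (P : submodule V) :
  inverted_closed P -> @inverted_fib _ T (submod_type P : lmodType R) V (submod_incl P).
Proof.
move=> Pc A B f finv a b ab.
have Pb x : P (ap b x).
  apply: (Pc _ _ _ _ finv) => y; rewrite -compE -ab compE.
  exact: submod_inclP.
exists (submod_lift Pb); split; apply: linear_ext => x //.
by apply: submod_incl_inj; rewrite compE submod_liftE -compE -ab.
Qed.

(** The map k gives T e a left inverse r. That r is also a right inverse is tested on [η_N], by
    minimality of the closure. *)
Lemma closure_inverted (X V : Mod R) (g : hom X V) (k : hom V (T X)) :
  k ∘ g = munit T X ->
  @inverted _ T X (submod_type (closure g) : lmodType R)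
    (submod_lift (@closure_gen X V g)).
Proof.
set N : Mod R := (submod_type _ : lmodType R); set e : hom X N := submod_lift _ => kg.
pose kN : hom N (T X) := k ∘ (submod_incl (closure g) : @hom (Mod R) N V).
have kNe : kN ∘ e = munit T X by rewrite -kg; apply: linear_ext.
have [s [sK _]] := idem X.
pose r := s ∘ fmap T kN.
have re : r ∘ fmap T e = idm (T X) by rewrite -compmA -fmap_comp kNe.
pose w : hom N (T N) := fmap T e ∘ (r ∘ munit T N).
have we : w ∘ e = munit T N ∘ e.
  by rewrite -(compmA (fmap T e)) -(compmA r) munit_nat (compmA r) re comp1m.
(* The equalizer of w and [η_N], taken inside V rather than N so that it competes with the
   closure. *)
have [Q QE] : exists Q : submodule V, forall v, Q v <->
    exists z, submod_incl (closure g) z = v /\ ap w z = ap (munit T N) z.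
  unshelve eexists (@Submodule R V (fun v : V =>
    exists z, submod_incl (closure g) z = v /\ ap w z = ap (munit T N) z) _ _).
  - by exists 0; rewrite !linear0.
  - move=> a u v [y [yu wy]] [z [zv wz]]; exists (a *: y + z).
    by rewrite !linearP yu zv wy wz.
  by [].
have Qc : inverted_closed Q.
  move=> A B f b finv bf x.
  have bN y : closure g (ap b y).
    apply: (closure_closed finv) => a; have /QE [z [<- _]] := bf a.
    exact: submod_inclP.
  pose b' : hom B N := submod_lift bN.
  apply/QE; exists (ap b' x); split; first exact: submod_liftE.
  (* Maps into T N are determined by their restriction along f, so the equalizer is closed. *)
  rewrite -!compE; apply: hom_app; apply: (inverted_separated finv).
  apply: linear_ext => a; have /QE [z [zE wz]] := bf a.
  have bz : ap b' (ap f a) = z by apply: submod_incl_inj; rewrite submod_liftE zE.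
  by rewrite !(compE _ f) !(compE _ b') bz.
have Qg x : Q (ap g x).
  apply/QE; exists (ap e x); split; first exact: submod_liftE.
  by rewrite -!compE we.
have wE : w = munit T N.
  apply: linear_ext => z.
  (* Membership in the closure, applied to Q itself. *)
  by have /QE [z' [/submod_incl_inj ->]] := submod_inclP z Q Qc Qg.
(* T e ∘ r and the identity agree after [η_N], which T inverts. *)
exists r; split=> //; apply: (inverted_separated (idem N)).
by rewrite comp1m -compmA.
Qed.

(** The factor TX of the product serves to make [η_X] extend over the closure; being local, it
    leaves the projection to Y a fibration. *)
Lemma mod_factor (X Y : Mod R) (f : hom X Y) :
  exists (Z : Mod R) (i : hom X Z) (p : hom Z Y),
    [/\ f = p ∘ i, inverted T i & inverted_fib T p].
Proof.
have prodP := @mod_product R Y (T X).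
set V : Mod R := (Y * _)%type in prodP.
set p1 := linear_of _ in prodP; set p2 := linear_of _ in prodP.
have [g [[g1 g2] _]] := prodP _ f (munit T X).
set P := closure (g : {linear (X : lmodType R) -> V : lmodType R}).
pose incl : @hom (Mod R) (submod_type P : lmodType R) V := submod_incl P.
exists (submod_type P : lmodType R), (submod_lift (@closure_gen X V g)).
exists (compm (c := Mod R) p1 incl); split.
- by rewrite -g1; apply: linear_ext.
- exact: closure_inverted g2.
move=> A B u uinv a b ab.
(* The coordinate in TX, on which Y imposes no condition. *)
have [c cu] := inverted_extend (compm (c := Mod R) p2 (incl ∘ a)) uinv.
have [d [[d1 d2] _]] := prodP _ b c.
have [|h [hu hd]] := submod_incl_fib (@closure_closed X V g) uinv (a := a) (b := d).
  apply: (product_ext prodP); first by rewrite compmA ab [RHS]compmA d1.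
  by rewrite [RHS]compmA d2 cu.
by exists h; split=> //; rewrite -d1 -hd compmA.
Qed.

End ModFactor.

(** * Base change *)

Lemma mod_terminal (R : pzRingType) : is_terminal (C := Mod R) 'M[R]_(0, 0).
Proof.
move=> X; have z_lin : linear (fun _ : X : lmodType R => 0 : 'M[R]_(0, 0)).
  by move=> a u v; rewrite scaler0 addr0.
exists (linear_of z_lin); split=> // h _.
by apply: linear_ext => x; rewrite flatmx0 [RHS]flatmx0.
Qed.

Section BaseChangeMonad.
Variables (R S : comPzRingType) (phi : {rmorphism R -> S}).
Local Notation A := (restrict_scalars phi).
Local Notation T := (base_change_monad phi).

Lemma alg_mulrE (s t : A) : (alg_mulr t : {linear A -> A}) s = s * t.
Proof. by []. Qed.

Lemma multiplication_map_pure (s t : A) :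
  multiplication_map phi (pure_tensor s t) = s * t.
Proof. exact: tensor_lift_pure. Qed.

Lemma act_bilinear : is_bilinear (fun (a : R^o) (s : A) => (a : R) *: s).
Proof.
split=> [a b s|a s t|a b s|a b s]; rewrite ?scalerDl ?scalerDr //.
  by rewrite -scalerA.
by rewrite !scalerA mulrC.
Qed.

Lemma tensor_symm_mult_iso :
  (forall s : A, pure_tensor s (1 : A) = pure_tensor (1 : A) s) ->
  @is_iso (Mod R) (tensor A A) A (multiplication_map phi).
Proof.
move=> sym.
have lin : linear (fun s : A => pure_tensor s (1 : A)).
  by have [tDl _ tZl _] := pure_tensor_bilinear A A => a s t /=; rewrite tDl tZl.
exists (linear_of lin); split.
  apply: tensor_linear_ext => s t.
  rewrite mod_compE linear_ofE multiplication_map_pure mod_idE.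
  (* Multiplying the left factor of t ⊗ 1 = 1 ⊗ t by s gives ts ⊗ 1 = s ⊗ t. *)
  have := congr1 (tensor_map (alg_mulr s) (mod_id A)) (sym t).
  by rewrite !tensor_map_pure !mod_idE !alg_mulrE mul1r mulrC => ->.
by apply: linear_ext => s; rewrite mod_compE linear_ofE multiplication_map_pure mulr1.
Qed.

Lemma base_change_unit_slide (M : lmodType R) (m : M) (s : A) :
  munit T (T M) = fmap T (munit T M) ->
  pure_tensor (pure_tensor m s) (1 : A) = pure_tensor (pure_tensor m (1 : A)) s.
Proof.
move=> unitE; rewrite -[RHS](bc_map_pure (bc_unit phi M)).
exact: hom_app unitE.
Qed.

Lemma base_change_unit_symm :
  munit T (T R^o) = fmap T (munit T R^o) ->
  forall s : A, pure_tensor s (1 : A) = pure_tensor (1 : A) s.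
Proof.
move=> unitE s; pose act : {linear tensor R^o A -> A} := tensor_lift act_bilinear.
have actE a t : act (pure_tensor a t) = (a : R) *: t by apply: tensor_lift_pure.
(* Contracting R ⊗ S to S turns (1 ⊗ s) ⊗ 1 = (1 ⊗ 1) ⊗ s into the claim. *)
have := congr1 (tensor_map act (mod_id A))
  (base_change_unit_slide (1 : R^o) s unitE).
by rewrite !tensor_map_pure !actE !scale1r.
Qed.

(** Injectivity of the multiplication gives s ⊗ t = 1 ⊗ st, which makes μ a two-sided inverse of T
    η. *)
Lemma base_change_idempotent :
  @is_iso (Mod R) (tensor A A) A (multiplication_map phi) ->
  forall X, inverted T (munit T X).
Proof.
move=> [d [dK _]] X; exists (mmult T X); split; first exact: mmult_unitr.
have dE x : (d : {linear A -> tensor A A}) (multiplication_map phi x) = x.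
  exact: (hom_app x dK).
have mulI (s t : A) : pure_tensor s t = pure_tensor (1 : A) (s * t : A).
  by rewrite -[LHS]dE -[RHS]dE !multiplication_map_pure mul1r.
apply: tensor2_linear_ext => m s t.
rewrite [LHS](mod_compE (bc_map phi (bc_unit phi X))) bc_mult_pure bc_map_pure bc_unitE.
have lin : linear (fun s : A => pure_tensor (m : X : lmodType R) s).
  by have [_ tDr _ tZr] := pure_tensor_bilinear X A => a u v /=; rewrite tDr tZr.
(* Carries s ⊗ t = 1 ⊗ st along s ↦ m ⊗ s in the left factor. *)
have := congr1 (tensor_map (linear_of lin) (mod_id A)) (mulI s t).
by rewrite !tensor_map_pure.
Qed.

End BaseChangeMonad.

Theorem corollary4p4 (R S : comPzRingType) (phi : {rmorphism R -> S}) :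
  (exists M' : model_data (Mod R),
      bousfield_localization (discrete_model (Mod R)) M' /\
      fibrant_replacement_monad M' (base_change_monad phi))
  <->
  @is_iso (Mod R)
    (tensor (restrict_scalars phi) (restrict_scalars phi))
    (restrict_scalars phi)
    (multiplication_map phi).
Proof.
split=> [[M [[hM cofM _] hT]]|mult_iso].
  apply/tensor_symm_mult_iso/base_change_unit_symm.
  have all_cof X Y (f : hom X Y) : cof M f by apply/cofM.
  exact: (fibrant_replacement_unit hM all_cof hT (@mod_product _ _ _)).
have idem := base_change_idempotent mult_iso.
exists (localization (base_change_monad phi)); split.
  apply: localization_bousfield; last exact: mod_factor idem.
    exact: mod_finitely_complete.
  exact: mod_finitely_cocomplete.
exact: (localization_fibrant_replacement (@mod_terminal R)).
Qed.
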